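(* Let $\mathbf{A}$ be a finite algebra with an edge term. Then for every variety $W \subseteq \mathbb{V}(\mathbf{A})$, there is a finite algebra $\mathbf{B} \in W$ such that $W = \mathbb{V}(\mathbf{B})$.
   Context: An algebra is an algebraic structure of some fixed type, i.e. a set with operations interpreting a fixed set of finitary operation symbols. A variety is a class of algebras of a fixed type that consists of all algebras of this type satisfying some (possibly infinite) set of identities $s \approx t$, where $s,t$ are terms. For an algebra $\mathbf{A}$, $\mathbb{V}(\mathbf{A})$ denotes the smallest variety containing $\mathbf{A}$, i.e. the class of all algebras $\mathbf{B}$ of the same type that satisfy all identities satisfied by $\mathbf{A}$. For $k \ge 2$, a function $t : A^{k+1} \to A$ is a $k$-edge operation if for all $x,y \in A$ we have $t(y,y,x,\ldots,x) = t(y,x,y,x,\ldots,x) = x$ and, for all $i \in \{4,\ldots,k+1\}$, $t(x,\ldots,x,y,x,\ldots,x) = x$ with $y$ in position $i$. An algebra has an edge term if, for some $k \ge 2$, one of its term functions is a $k$-edge operation. *)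

(* Defs.v *)
From mathcomp Require Import all_boot.
From mathcomp Require Import classical_sets cardinality.

Set Implicit Arguments.
Unset Strict Implicit.
Unset Printing Implicit Defensive.

Local Open Scope classical_set_scope.

Record signature := Signature {
  symbol : Type;
  arity : symbol -> nat
}.

(* [T ^ n] is MathComp's [{ffun 'I_n -> T}]. The carrier is not required to be
   inhabited. *)
Record algebra (S : signature) := Algebra {
  carrier :> Type;
  interp : forall f : symbol S, (carrier ^ arity f)%type -> carrier
}.

Inductive term (S : signature) (X : Type) : Type :=
  | Var of X
  | App (f : symbol S) of (term S X ^ arity f)%type.

Fixpoint eval (S : signature) (A : algebra S) (X : Type) (v : X -> A)
    (t : term S X) : A :=
  match t with
  | Var x => v x
  | App f args => interp [ffun i => eval v (args i)]
  end.

Definition term_function (S : signature) (A : algebra S) (n : nat)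
    (t : term S 'I_n) : (A ^ n)%type -> A :=
  fun a => eval a t.
Arguments term_function {S} A {n} t _.

Definition satisfies (S : signature) (A : algebra S) (s t : term S nat) : Prop :=
  forall v : nat -> A, eval v s = eval v t.

Definition variety (S : signature) (W : set (algebra S)) : Prop :=
  exists E : set (term S nat * term S nat),
    W = [set B | forall s t, E (s, t) -> satisfies B s t].

Definition generated_variety (S : signature) (A : algebra S) :
    set (algebra S) :=
  [set B | forall s t, satisfies A s t -> satisfies B s t].

Lemma variety_generated_variety (S : signature) (A : algebra S) :
  variety (generated_variety A).
Proof. by exists [set st | satisfies A st.1 st.2]. Qed.

Lemma generated_variety_self (S : signature) (A : algebra S) :
  generated_variety A A.
Proof. by []. Qed.

Lemma generated_variety_smallest (S : signature) (A : algebra S)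
    (W : set (algebra S)) :
  variety W -> W A -> generated_variety A `<=` W.
Proof. by case=> E -> EA B AB s t Est; apply/AB/EA. Qed.

Definition finite_algebra (S : signature) (A : algebra S) : Prop :=
  finite_set [set: A].

(* Positions are numbered from 0: the paper's position [i] is the index
   [i.-1], so its range [4, ..., k + 1] becomes [3, ..., k]. *)
Definition edge_operation (T : Type) (k : nat) (t : (T ^ k.+1)%type -> T) :
    Prop :=
  forall x y : T,
    [/\ t [ffun i : 'I_k.+1 => if (i == 0 :> nat) || (i == 1 :> nat)
                               then y else x] = x,
        t [ffun i : 'I_k.+1 => if (i == 0 :> nat) || (i == 2 :> nat)
                               then y else x] = x
      & forall j : 'I_k.+1, 3 <= j ->
        t [ffun i : 'I_k.+1 => if i == j then y else x] = x].

Definition has_edge_term (S : signature) (A : algebra S) : Prop :=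
  exists k : nat, 2 <= k /\
    exists t : term S 'I_k.+1, edge_operation (term_function A t).

(* Main.v *)
Require Import Defs.
From mathcomp Require Import all_boot all_order.
From mathcomp Require Import boolp classical_sets cardinality.

(** Write [F n] for the algebra freely generated by [n] elements in the
    subvariety [W]; it is finite, because an identity of [W] in [n] variables
    depends only on the two functions [A^n -> A] that its sides define. The
    point is that for some [n] every identity of [F n], in whatever number of
    variables, is an identity of [W]; then [W] is generated by [F n].

    An identity [s = t] in [m] variables is read as the function
    [A^m -> A * A] whose components are the term functions of [s] and [t]. The
    identities of a class of algebras in the variety of [A] then form, for each
    [m], a subuniverse [R] of a power of [A * A], and the edge term of [A] acts
    on it as an edge operation. Order [A^m] lexicographically. The pair [(b, c)]
    is a fork of [R] at [w] if two members of [R] that agree below [w] take the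
    values [b] and [c] at [w]. Two nested subuniverses with the same forks and
    the same projections to fewer than [k] coordinates are equal
    ([edge_interpolation]): for a Malcev operation this is Gaussian elimination
    along the order, for a near-unanimity operation it is the Baker-Pixley
    theorem, and an edge operation interleaves the two arguments.

    So it is enough to bound the number of variables that decide these data for
    the identities of [W]. Projections to fewer than [k] coordinates are visible
    in about [|A|^k] variables, as variables that are assigned the same values
    at all these coordinates can be identified ([minor_small_support]). For forks,
    compare words: if [v] arises from [u] by inserting letters that
    already occur further left, then the corresponding identification of
    variables respects the lexicographic order, so every fork at [v] is a fork
    at [u] ([fork_rigid]). Hence the words at which [W] lacks a given fork are
    closed under such insertions. By Higman's lemma this insertion order is a
    well-quasi-order, so these words are all obtained from words of bounded
    length ([rigid_minor_basis]). As [F n] and [W] have the same identities in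
    at most [n] variables, they have the same forks at short words, hence at
    all words. *)

Set Implicit Arguments.
Unset Strict Implicit.
Unset Printing Implicit Defensive.

(** * Higman's lemma *)

Lemma uniform_bound (I : finType) (Q : I -> nat -> Prop) :
    (forall i m n, m <= n -> Q i m -> Q i n) -> (forall i, exists n, Q i n) ->
  exists n, forall i, Q i n.
Proof.
move=> Qmono /choice[b Qb]; exists (\max_i b i) => i.
exact: Qmono (leq_bigmax i) (Qb i).
Qed.

Definition bad_sequence (T : eqType) (f : nat -> seq T) : Prop :=
  forall i j, i < j -> ~~ subseq (f i) (f j).

(** The sequence is built by fixing its terms one after another, each of least
    length among the bad sequences that continue the terms already fixed; its
    [n]-th term is read off the [n.+1]-st approximation. *)
Lemma minimal_bad_sequence (T : eqType) (f : nat -> seq T) :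
    bad_sequence f ->
  exists2 g : nat -> seq T, bad_sequence g &
    forall n (h : nat -> seq T), bad_sequence h -> (forall i, i < n -> h i = g i) ->
      size (g n) <= size (h n).
Proof.
move=> badf.
have /choice[next nextP] (p : nat * (nat -> seq T)) :
    exists g : nat -> seq T,
    bad_sequence p.2 ->
    [/\ bad_sequence g, forall i, i < p.1 -> g i = p.2 i &
      forall h : nat -> seq T, bad_sequence h -> (forall i, i < p.1 -> h i = p.2 i) ->
        size (g p.1) <= size (h p.1)].
  case: (pselect (bad_sequence p.2)) => [badp|nbadp]; last by exists p.2.
  pose sz s := `[< exists h : nat -> seq T, [/\ bad_sequence h,
    forall i, i < p.1 -> h i = p.2 i & size (h p.1) = s] >].
  have exsz : exists s, sz s by exists (size (p.2 p.1)); apply/asboolP; exists p.2.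
  case: (ex_minnP exsz) => s /asboolP[g [badg gp <-]] smin.
  exists g => _; split=> // h badh hp; apply: smin.
  by apply/asboolP; exists h.
have [F Fbad Fnext] : exists2 F : nat -> nat -> seq T,
    forall n, bad_sequence (F n) &
    forall n, (forall i, i < n -> F n.+1 i = F n i) /\
      forall h, bad_sequence h -> (forall i, i < n -> h i = F n i) ->
        size (F n.+1 n) <= size (h n).
  pose fix F n := if n is n'.+1 then next (n', F n') else f.
  have Fbad n : bad_sequence (F n).
    by elim: n => //= n IHn; have [] := nextP (n, F n) IHn.
  by exists F => // n; have [] := nextP (n, F n) (Fbad n).
have FE i m : i < m -> F m i = F i.+1 i.
  elim: m => // m IHm; rewrite ltnS leq_eqVlt => /predU1P[-> //|im].
  by rewrite (Fnext m).1// IHm.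
exists (fun n => F n.+1 n) => [i j ij|n h badh hF].
  by rewrite -(FE i j.+1 (leqW ij)); apply: Fbad.
apply: (Fnext n).2 => // i lin.
by rewrite hF// (FE i n lin).
Qed.

Lemma infinitely_often (T : finType) (c : nat -> T) :
  exists x, forall n, exists2 i, n <= i & c i = x.
Proof.
apply: contrapT => /forallNP nc.
have [|x|n nP] := @uniform_bound T (fun x n => forall i, n <= i -> c i <> x).
- by move=> x m n mn cx i ni; apply/cx/(leq_trans mn).
- have /existsNP[n cx] := nc x; exists n => i ni cix.
  by apply: cx; exists i.
by have := nP (c n) n (leqnn n).
Qed.

(** In a minimal bad sequence some letter [x] is the head of infinitely many
    terms. Dropping the terms from the first of these on, and continuing with the
    tails of the words that start with [x], gives again a bad sequence, but a
    smaller one. *)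
Theorem higman (T : finType) (f : nat -> seq T) :
  exists i j, i < j /\ subseq (f i) (f j).
Proof.
apply: contrapT => /forallNP nf.
have [i j ij|g badg gmin] := @minimal_bad_sequence T f.
  by apply/negP => fij; apply: (nf i); exists j.
have gN0 i : g i <> [::].
  by move=> gi0; have := badg i i.+1 (ltnSn i); rewrite gi0 sub0seq.
have [[x|]] := infinitely_often (fun i => ohead (g i)); last first.
  by case/(_ 0) => i _; case: (g i) (gN0 i).
move=> /= often.
have /choice[next nextP] n : exists i, n <= i /\ ohead (g i) = Some x.
  by have [i ni gi] := often n; exists i.
pose fix idx k := if k is k'.+1 then next (idx k').+1 else next 0.
have idx_lt i j : i < j -> idx i < idx j.
  apply: (homo_ltn (f := idx) ltn_trans) => k.
  by have [] := nextP (idx k).+1.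
have gidx k : g (idx k) = x :: behead (g (idx k)).
  have : ohead (g (idx k)) = Some x by case: k => [|k]; exact: (nextP _).2.
  by case: (g _) => //= y s [->].
(* [idx 0] is the first position where [h] differs from [g]. *)
pose h i := if i < idx 0 then g i else behead (g (idx (i - idx 0))).
have badh : bad_sequence h.
  move=> i j ij; rewrite /h; case: (ltnP i) => [i0|i0].
    case: ltnP => [j0|j0]; first exact: badg.
    have ij' : i < idx (j - idx 0).
      apply: leq_trans i0 _; case: (j - _) => // k; exact/ltnW/idx_lt.
    apply: contra (badg _ _ ij') => sub; rewrite gidx.
    exact: subseq_trans sub (subseq_cons _ _).
  have j0 := leq_trans i0 (ltnW ij); rewrite ltnNge j0 /=.
  have := badg _ _ (idx_lt _ _ (ltn_sub2r (leq_ltn_trans i0 ij) ij)).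
  by rewrite gidx [X in subseq _ X]gidx /= eqxx.
have : size (g (idx 0)) <= size (h (idx 0)).
  by apply: gmin => // i i0; rewrite /h i0.
by rewrite /h ltnn subnn gidx /= ltnn.
Qed.

(** Otherwise there is, for each bound, a member of [P] whose code lies above
    no code of a member of [P] within the bound; raising the bound each time past
    the member just chosen yields a bad sequence. *)
Theorem higman_basis (T : finType) (U : Type) (code : U -> seq T)
    (rank : U -> nat) (P : U -> Prop) :
  exists n, forall u, P u ->
    exists2 u0, P u0 /\ rank u0 <= n & subseq (code u0) (code u).
Proof.
apply: contrapT => /forallNP noP.
have /choice[w wP] n : exists u, P u /\ forall u0, P u0 -> rank u0 <= n ->
    ~~ subseq (code u0) (code u).
  have /existsNP[u /not_implyP[Pu nu]] := noP n; exists u; split=> // u0 Pu0 n0.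
  by apply/negP => sub; apply: nu; exists u0.
(* [b k] bounds the ranks of the members of [P] chosen before step [k]. *)
pose fix b k := if k is k'.+1 then maxn (b k') (rank (w (b k'))) else 0.
have [i [j [ij sub]]] := @higman T (fun k => code (w (b k))).
have rank_le : rank (w (b i)) <= b j.
  elim: j ij {sub} => // j IHj; rewrite ltnS leq_eqVlt => /predU1P[<-|/IHj ij] /=.
    exact: leq_maxr.
  exact: leq_trans ij (leq_maxl _ _).
by have := (wP (b j)).2 _ (wP (b i)).1 rank_le; rewrite sub.
Qed.

(** * Inserting repeated letters *)

Section RigidSurjections.

Variable T : finType.
Implicit Types (x : T) (u v : seq T) (s : nat -> nat).

(** [s] presents [v] as [u] with additional letters, each of them occurring
    already further left in [v]: the first occurrences of the values of [s] come
    in increasing order, so that [s] is a rigid surjection. *)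
Definition rigid_minor s u v : Prop :=
  [/\ forall j, j < size v -> s j < size u,
      forall x j, j < size v -> nth x u (s j) = nth x v j
    & forall i, i < size u -> exists2 j, j < size v /\ s j = i &
        forall j', j' < j -> s j' < i].

(** Words are read here from right to left, so that the head is the last letter
    and its mark is the set of letters preceding it. *)
Fixpoint marked (w : seq T) : seq (T * {set T}) :=
  if w is x :: w' then (x, [set y in w']) :: marked w' else [::].

Lemma marked_fst w : [seq p.1 | p <- marked w] = w.
Proof. by elim: w => //= x w ->. Qed.

(** If the head of [v] is not matched, then [u] embeds into the rest of [v];
    as [u] and [v] have the same letters, the head of [v] must occur in this
    rest. If it is matched, the equal marks say that the remaining words have the
    same letters again. *)
Lemma rigid_minor_of_marked u v :
    subseq (marked u) (marked v) -> u =i v ->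
  exists s, rigid_minor s (rev u) (rev v).
Proof.
elim: v u => [|y v IHv] u.
  case: u => [_ _|x u //]; exists id; split=> //.
case: u => [_ /(_ y)|x u]; first by rewrite in_nil mem_head.
rewrite [marked (y :: v)]/= [marked (x :: u)]/= => /=.
case: eqP => [[<- euv] sub _|_ sub euv].
  have [|s [s_lt s_nth s_first]] := IHv u sub.
    by move=> z; have /setP/(_ z) := euv; rewrite !inE.
  exists (fun j => if j == size v then size u else s j).
  rewrite !rev_cons; split.
  - move=> j; rewrite !size_rcons !size_rev ltnS leq_eqVlt.
    case: eqP => [//|_ /= jv]; apply: ltnW; rewrite ltnS.
    by have := s_lt j; rewrite !size_rev; apply.
  - move=> z j; rewrite size_rcons size_rev ltnS leq_eqVlt !nth_rcons !size_rev.
    case: eqP => [-> _|_ /= jv]; first by rewrite !ltnn !eqxx.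
    have := s_lt j; have := s_nth z j; rewrite !size_rev jv.
    by move=> /(_ isT) -> /(_ isT) ->.
  - move=> i; rewrite size_rcons size_rev ltnS leq_eqVlt => /predU1P[->|iu].
      exists (size v); first by rewrite size_rcons size_rev eqxx ltnSn.
      move=> j jv; rewrite ltn_eqF//.
      by have := s_lt j; rewrite !size_rev; apply.
    have := s_first i; rewrite !size_rev => /(_ iu)[j [jv <-] jfirst].
    exists j; first by rewrite size_rcons size_rev ltnS ltnW// ltn_eqF.
    by move=> j' j'j; rewrite ltn_eqF ?(ltn_trans j'j)//; apply: jfirst.
(* The letter [y] of [v] is not matched. *)
have uv : {subset x :: u <= v}.
  move=> z; rewrite -[X in z \in X -> _]marked_fst -[X in _ -> z \in X]marked_fst.
  by apply: mem_subseq; apply: map_subseq.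
have yv : y \in v by apply: uv; rewrite euv mem_head.
have [|s [s_lt s_nth s_first]] := IHv (x :: u) sub.
  move=> z; rewrite euv inE; case: eqP => [->|//]; by rewrite yv.
have yu : index y (rev (x :: u)) < size (rev (x :: u)).
  by rewrite index_mem mem_rev euv mem_head.
exists (fun j => if j == size v then index y (rev (x :: u)) else s j).
move: (rev (x :: u)) s_lt s_nth s_first yu.
move=> {sub euv uv} {}u s_lt s_nth s_first yu.
rewrite rev_cons; split.
- move=> j; rewrite size_rcons size_rev ltnS leq_eqVlt.
  by case: eqP => //= _; rewrite -size_rev; apply: s_lt.
- move=> z j; rewrite size_rcons size_rev ltnS leq_eqVlt nth_rcons size_rev.
  case: eqP => [-> _|_ /= jv]; first by rewrite ltnn nth_index// -index_mem.
  by rewrite jv; apply: s_nth; rewrite size_rev.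
- move=> i iu; have [j [jv sji] jfirst] := s_first i iu.
  rewrite size_rev in jv; exists j.
    by rewrite size_rcons size_rev ltnS ltnW// ltn_eqF.
  by move=> j' j'j; rewrite ltn_eqF ?(ltn_trans j'j)//; apply: jfirst.
Qed.

(** The bound is uniform over finitely many properties, here one for each pair
    of values of a fork; the letter set of a word is treated as a part of the
    property because [rigid_minor_of_marked] compares words with equal letter
    sets. *)
Theorem rigid_minor_basis (I : finType) (P : I -> seq T -> Prop) :
  exists n, forall i v, P i v ->
    exists2 u, P i u /\ size u <= n & exists s, rigid_minor s u v.
Proof.
have [|[i L]|n nP] := @uniform_bound _ (fun (iL : I * {set T}) n =>
  forall v, P iL.1 (rev v) /\ [set x in v] = iL.2 ->
  exists2 u, (P iL.1 (rev u) /\ [set x in u] = iL.2) /\ size u <= n &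
    subseq (marked u) (marked v)).
- move=> [i L] m n mn Pm v Pv; have [u [Pu um] uv] := Pm v Pv.
  by exists u => //; split=> //; apply: leq_trans um mn.
- exact: higman_basis.
exists n => i v Piv; have [|u [[Pu uL] un] uv] := nP (i, [set x in v]) (rev v).
  by split; rewrite ?revK//; apply/setP => x; rewrite !inE mem_rev.
exists (rev u); rewrite ?size_rev//; rewrite -[v]revK.
apply: rigid_minor_of_marked uv _ => x.
by have /setP/(_ x) := uL; rewrite !inE mem_rev.
Qed.

End RigidSurjections.
(** * Subuniverses closed under an edge operation *)

Section Interpolation.

Variables (disp : Order.disp_t) (I : finOrderType disp) (B : finType).
Variables (k : nat) (e : (B ^ k.+1)%type -> B).
Hypotheses (k_ge2 : 2 <= k) (edge_e : edge_operation e).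
Implicit Types (R : set (I -> B)) (i x : I) (T : {set I}).

Definition closed_under R : Prop :=
  forall F : 'I_k.+1 -> I -> B, (forall j, R (F j)) ->
    R (fun i => e [ffun j => F j i]).

Definition fork R i (b c : B) : Prop :=
  exists f g : I -> B,
    [/\ R f, R g, forall x, (x < i)%O -> f x = g x, f i = b & g i = c].

Let ge2 (j : 'I_k.+1) : j <> 0 :> nat -> j <> 1 :> nat -> 2 <= j <= k.
Proof.
by rewrite -[j <= k]ltnS ltn_ord andbT; case: (nat_of_ord j) => [|[]].
Qed.

Let edge01 (a : 'I_k.+1 -> B) b c :
    (forall j, a j = if (j == 0 :> nat) || (j == 1 :> nat) then c else b) ->
  e [ffun j => a j] = b.
Proof.
move=> aE; have [<- _ _] := edge_e b c; congr e.
by apply/ffunP => j; rewrite !ffunE aE.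
Qed.

Let edge02 (a : 'I_k.+1 -> B) b c :
    (forall j, a j = if (j == 0 :> nat) || (j == 2 :> nat) then c else b) ->
  e [ffun j => a j] = b.
Proof.
move=> aE; have [_ <- _] := edge_e b c; congr e.
by apply/ffunP => j; rewrite !ffunE aE.
Qed.

Let edge_at (l : 'I_k.+1) (a : 'I_k.+1 -> B) b c : 3 <= l ->
    (forall j, a j = if j == l then c else b) ->
  e [ffun j => a j] = b.
Proof.
move=> l3 aE; have [_ _ /(_ l l3) <-] := edge_e b c; congr e.
by apply/ffunP => j; rewrite !ffunE aE.
Qed.

Let edge_const (a : 'I_k.+1 -> B) b : (forall j, a j = b) ->
  e [ffun j => a j] = b.
Proof. by move=> aE; apply: (@edge01 _ b b) => j; rewrite aE if_same. Qed.

(** Let [q j] agree with [s] except at [t j]. At any given point at most one of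
    the arguments [q j] is wrong. If it is [q 2], then the arguments in
    positions 0 and 2 are wrong in the same way, and the second edge identity
    repairs it; every other [q j] is repaired by its own edge identity. *)
Let edge_near_unanimous (t : nat -> I) (s : I -> B) (q : nat -> I -> B) x
    (a : 'I_k.+1 -> B) :
    {in [pred j | 2 <= j <= k] &, injective t} ->
    (forall j, 2 <= j <= k -> x != t j -> q j x = s x) ->
    (forall j : 'I_k.+1, a j = if j == 0 :> nat then q 2 x
                     else if j == 1 :> nat then s x else q j x) ->
  e [ffun j => a j] = s x.
Proof.
move=> t_inj qE aE.
have [/existsP[l /andP[l2 /eqP xt]]|] :=
    boolP [exists l : 'I_k.+1, (2 <= l) && (x == t l)]; last first.
  rewrite negb_exists => /forallP xt; apply: edge_const => j; rewrite aE.
  have t2 : x != t 2.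
    by have := xt (Ordinal (k_ge2 : 2 < k.+1)); rewrite leqnn.
  case: eqP => [_|j0]; first by rewrite qE// leqnn.
  case: eqP => [//|j1]; have jk := ge2 j0 j1.
  by apply: qE => //; have := xt j; case/andP: jk => ->.
have lk : 2 <= l <= k by rewrite l2 -ltnS ltn_ord.
have others j : 2 <= j <= k -> j != l -> q j x = s x.
  move=> jk jl; apply: qE => //; apply: contra jl => /eqP xtj.
  by apply/eqP; apply: t_inj; rewrite -?xtj.
have [l_eq2|l_neq2] := eqVneq (l : nat) 2.
  apply: (@edge02 _ (s x) (q 2 x)) => j; rewrite aE.
  case: eqP => //= j0; case: eqP => [->//|j1].
  case: eqP => [->//|/eqP j2]; apply: others; last by rewrite l_eq2.
  exact: ge2.
have l3 : 3 <= l by rewrite ltn_neqAle eq_sym l_neq2.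
apply: (@edge_at l _ (s x) (q l x)) => // j; rewrite aE.
have [->|jl] := eqVneq j l; first by rewrite !gtn_eqF// ltnW.
case: eqP => j0; first by rewrite others ?leqnn// eq_sym.
by case: eqP => // j1; apply: others => //; apply: ge2.
Qed.

Variables (R S : set (I -> B)).
Hypotheses (closedR : closed_under R) (closedS : closed_under S).
Hypothesis forkSR : forall i b c, fork S i b c -> fork R i b c.
Hypothesis smallSR : forall s T, S s -> #|T| < k ->
  exists2 r, R r & {in T, r =1 s}.

(** Let [r] in [R] agree with [s] below [i]. By induction on [T], for each
    [j] with [2 <= j <= k] there is [q j] in [R] that agrees with [s] on
    [i |: T] except at a point [t j]. The only obstacle to combining them is the
    value at [i] of the argument in position 1. Put
    [D y := e (s i, y, s i, ..., s i)]. Combining the [q j] with an [h] that is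
    right on [T] keeps it right on [T] and replaces [h i] by [D (h i)]. Hence [R]
    has members [h] that agree with [s] on [T] and have any value
    [iter m D (r i)] at [i]. Among these values choose one that is periodic,
    [h i = D (g i)] where [g] in [S] agrees with [s] below [i]. Then
    [(s i, g i)] is a fork, first of [S] and so of [R], and a fork turns [q 2]
    into a member [z] of [R] with [z = q 2] below [i] and [z i = h i]. Now
    [e (z, h, q 2, ..., q k)] is right at [i] by the first edge identity and on
    [T] by [edge_near_unanimous]. *)
Let extend_agreement (s r : I -> B) i T : S s -> R r -> S r ->
    (forall x, (x < i)%O -> r x = s x) -> (forall x, x \in T -> (x < i)%O) ->
  exists2 f, R f & f i = s i /\ {in T, f =1 s}.
Proof.
move=> Ss Rr Sr rs; move: {2}#|T| (leqnn #|T|) => n.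
elim: n T => [|n IHn] T Tn Ti.
  have [|f Rf fs] := @smallSR s [set i] Ss; first by rewrite cards1.
  exists f => //; split=> [|x]; first by apply: fs; rewrite inE.
  by move: Tn; rewrite leqn0 cards_eq0 => /eqP ->; rewrite inE.
(* There is no room for [k.-1] distinct points in [T]: use small projections. *)
have [Tk|kT] := ltnP #|T|.+1 k.
  have [|f Rf fs] := @smallSR s (i |: T) Ss.
    by apply: leq_ltn_trans Tk; rewrite cardsU1 -add1n leq_add2r leq_b1.
  by exists f => //; split=> [|x xT]; apply: fs; rewrite !inE ?eqxx ?xT ?orbT.
pose t j := nth i (enum T) (j - 2).
have t_lt j : 2 <= j <= k -> j - 2 < size (enum T).
  case/andP=> j2 jk; rewrite -cardE -ltnS; apply: leq_trans kT.
  by rewrite -addn2 subnK.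
have t_inj : {in [pred j | 2 <= j <= k] &, injective t}.
  move=> j j'; rewrite !inE => jk j'k /eqP.
  rewrite nth_uniq ?t_lt// ?enum_uniq// => /eqP.
  case/andP: jk j'k => j2 _ /andP[j'2 _] /(congr1 (addn^~ 2)).
  by rewrite !subnK.
have /choice[q qP] j : exists f, 2 <= j <= k ->
    [/\ R f, f i = s i & {in T, forall x, x != t j -> f x = s x}].
  have [jk|_] := boolP (2 <= j <= k); last by exists s.
  have tT : t j \in T by rewrite -mem_enum mem_nth// t_lt.
  have [||f Rf [fi fs]] := IHn (T :\ t j).
  - by move: Tn; rewrite (cardsD1 (t j)) tT.
  - by move=> x; rewrite inE => /andP[_]; apply: Ti.
  by exists f => _; split=> // x xT xt; apply: fs; rewrite !inE xt.
have qR j : 2 <= j <= k -> R (q j) by case/qP.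
have qi j : 2 <= j <= k -> q j i = s i by case/qP.
have qT x : x \in T -> forall j, 2 <= j <= k -> x != t j -> q j x = s x.
  by move=> xT j jk xt; have [_ _] := qP j jk; apply.
have k22 : 2 <= 2 <= k by rewrite leqnn.
pose D y := e [ffun j : 'I_k.+1 => if j == 1 :> nat then y else s i].
(* These values are taken by members of [S] right at all points below [i]. *)
have valS m : exists g, [/\ S g, forall x, (x < i)%O -> s x = g x &
    g i = iter m D (r i)].
  elim: m => [|m [g [Sg gs gi]]]; first by exists r; split=> // x /rs.
  exists (fun x => e [ffun j : 'I_k.+1 => (if j == 1 :> nat then g else s) x]).
  split=> [|x xi|].
  - by apply: closedS => j; case: eqP.
  - by apply/esym/edge_const => j; case: eqP => // _; rewrite gs.
  - by rewrite iterS -gi; congr e; apply/ffunP => j; rewrite !ffunE; case: eqP.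
have valR m : exists h, [/\ R h, {in T, h =1 s} & h i = iter m D (r i)].
  elim: m => [|m [h [Rh hs hi]]]; first by exists r; split=> // x /Ti/rs.
  exists (fun x => e [ffun j : 'I_k.+1 => (if j == 0 :> nat then q 2
    else if j == 1 :> nat then h else q j) x]); split=> [|x xT|].
  - apply: closedR => j; case: eqP => j0; first exact: qR.
    by case: eqP => j1 //; apply/qR/ge2.
  - apply: (edge_near_unanimous t_inj (qT x xT)) => j.
    by case: eqP => //; case: eqP => // _ _; apply: hs.
  - rewrite iterS -hi; congr e; apply/ffunP => j; rewrite !ffunE.
    case: eqP => [-> /=|j0]; first exact: qi.
    by case: eqP => j1 //; apply/qi/ge2.
have [m m_lt loop] : exists2 m, m < order D (r i) &
    iter (order D (r i)) D (r i) = iter m D (r i).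
  by apply/trajectP; apply: (loopingP (looping_order D (r i))).
have [h [Rh hs hi]] := valR m.
case: (order D (r i)) m_lt loop => // m' _; rewrite iterS => loop.
have [g [Sg gs gi]] := valS m'.
have [|u [v [Ru Rv uv ui vi]]] := forkSR (i := i) (b := s i) (c := g i).
  by exists s, g.
pose z x := e [ffun j : 'I_k.+1 => (if j == 0 :> nat then u
  else if j == 1 :> nat then v else q 2) x].
have Rz : R z.
  by apply: closedR => j; case: eqP => // _; case: eqP => // _; apply: qR.
have z_below x : (x < i)%O -> z x = q 2 x.
  move=> xi; apply: (@edge01 _ _ (u x)) => j.
  by case: eqP => //= _; case: eqP => //= _; rewrite uv.
have z_at : z i = h i.
  rewrite hi -loop -gi; congr e; apply/ffunP => j; rewrite !ffunE.
  by case: eqP => [-> //|j0]; case: eqP => // j1; apply: qi.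
exists (fun x => e [ffun j : 'I_k.+1 => (if j == 0 :> nat then z
    else if j == 1 :> nat then h else q j) x]).
  apply: closedR => j; case: eqP => // j0; case: eqP => // j1.
  exact/qR/ge2.
split=> [|x xT].
  apply: (@edge01 _ _ (h i)) => j.
  by case: eqP => j0; last case: eqP => j1 //; rewrite ?z_at//; apply/qi/ge2.
apply: (edge_near_unanimous t_inj (qT x xT)) => j.
case: eqP => _; first by rewrite z_below// Ti.
by case: eqP => // _; apply: hs.
Qed.

(** Agreement with [s] is extended one point at a time in increasing order, by
    [extend_agreement] with all smaller points for [T]. *)
Theorem edge_interpolation (subRS : (R `<=` S)%classic) s : S s ->
  exists2 r, R r & r =1 s.
Proof.
move=> Ss; pose rank i := #|[set x | (x < i)%O]|.
have rank_lt x i : (x < i)%O -> rank x < rank i.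
  move=> xi; apply/proper_card/properP; split.
    by apply/fintype.subsetP => y; rewrite !inE => /Order.POrderTheory.lt_trans; apply.
  by exists x; rewrite !inE ?xi// Order.POrderTheory.ltxx.
suff /(_ #|I|.+1)[r Rr rs] n : exists2 r, R r & forall x, rank x < n -> r x = s x.
  by exists r => // x; apply: rs; rewrite ltnS; apply: max_card.
elim: n => [|n [r Rr rs]].
  by have [|r Rr _] := @smallSR s finset.set0 Ss; [rewrite cards0 ltnW|exists r].
have [/existsP[i /eqP ri]|] := boolP [exists i, rank i == n]; last first.
  rewrite negb_exists => /forallP no; exists r => // x.
  by rewrite ltnS leq_eqVlt (negbTE (no x)); apply: rs.
have [//|||f Rf [fi fs]] := @extend_agreement s r i [set x | (x < i)%O] Ss Rr.
- exact: subRS.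
- by move=> x /rank_lt; rewrite ri; apply: rs.
- by move=> x; rewrite inE.
exists f => // x; rewrite ltnS -ri.
case: (Order.TotalTheory.ltgtP x i) => [xi _|/rank_lt ix|-> _//].
  by apply: fs; rewrite inE.
by rewrite leqNgt ix.
Qed.

End Interpolation.
(** * Identities and free algebras *)

Section Terms.

Variable Sg : signature.
Implicit Types (A C : algebra Sg) (K W : set (algebra Sg)).

(** The arguments of [App] sit inside a finite function, so the induction
    hypothesis for them has to be provided by hand. *)
Fixpoint term_induction (X : Type) (P : term Sg X -> Prop)
    (PVar : forall x, P (Var Sg x))
    (PApp : forall f (args : (term Sg X ^ arity f)%type),
      (forall i, P (args i)) -> P (App args))
    (t : term Sg X) : P t :=
  match t with
  | Var x => PVar x
  | App f args => PApp f args (fun i => term_induction PVar PApp (args i))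
  end.

Fixpoint subst (X Y : Type) (u : X -> term Sg Y) (t : term Sg X) : term Sg Y :=
  match t with
  | Var x => u x
  | App f args => App [ffun i => subst u (args i)]
  end.

Definition rename (X Y : Type) (u : X -> Y) : term Sg X -> term Sg Y :=
  subst (fun x => Var Sg (u x)).

Lemma eq_eval A X (v v' : X -> A) (t : term Sg X) :
  v =1 v' -> eval v t = eval v' t.
Proof.
move=> vv'; elim/term_induction: t => [x|f args IH] /=; first exact: vv'.
by congr interp; apply/ffunP => i; rewrite !ffunE IH.
Qed.

Lemma eval_subst A X Y (v : Y -> A) (u : X -> term Sg Y) t :
  eval v (subst u t) = eval (fun x => eval v (u x)) t.
Proof.
elim/term_induction: t => [x|f args IH] //=.
by congr interp; apply/ffunP => i; rewrite !ffunE IH.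
Qed.

Lemma eval_rename A X Y (v : Y -> A) (u : X -> Y) t :
  eval v (rename u t) = eval (v \o u) t.
Proof. exact: eval_subst. Qed.

Lemma rename_finite_support (t : term Sg nat) :
  exists m, forall n, m <= n ->
    rename (@nat_of_ord n.+1) (rename (@inord n) t) = t.
Proof.
elim/term_induction: t => [x|f args /choice[m mP]].
  by exists x => n xn; rewrite /rename /= inordK.
exists (\max_i m i) => n mn; rewrite /rename /=; congr App.
apply/ffunP => i; rewrite !ffunE; apply: mP.
exact: leq_trans (leq_bigmax i) mn.
Qed.

Definition valid K X (s t : term Sg X) : Prop :=
  forall C, K C -> forall v : X -> C, eval v s = eval v t.

Lemma valid_rename K X Y (u : X -> Y) s t :
  valid K s t -> valid K (rename u s) (rename u t).
Proof. by move=> Kst C KC v; rewrite !eval_rename; apply: Kst. Qed.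

Lemma valid_rename_cancel K X Y (u : X -> Y) (u' : Y -> X) s t :
  cancel u u' -> valid K (rename u s) (rename u t) -> valid K s t.
Proof.
move=> uK Kst C KC v; have := Kst C KC (v \o u'); rewrite !eval_rename.
by rewrite !(@eq_eval C _ ((v \o u') \o u) v)// => x /=; rewrite uK.
Qed.

(** Identities in [n.+1] variables and identities in variables indexed by [nat]
    translate into each other because there is at least one variable. *)
Lemma valid_of_generator K A n (s t : term Sg 'I_n.+1) :
    (K `<=` generated_variety A)%classic ->
    (forall v : 'I_n.+1 -> A, eval v s = eval v t) -> valid K s t.
Proof.
move=> KA Ast; apply: (@valid_rename_cancel _ _ _ val inord); first exact: inord_val.
move=> C /KA; apply => v; rewrite !eval_rename; exact: Ast.
Qed.

(** [F] is the free algebra of [W] over [X], the algebra of terms modulo the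
    identities of [W]. A class of terms is represented by the set of codes of its
    members, and this set by its number in the enumeration of all such sets; in
    this way the carrier is a bounded set of natural numbers, small enough
    to be the carrier of an algebra in the given universe. *)
Theorem finite_free_algebra W X (Z : finType) (code : term Sg X -> Z) :
    variety W -> (forall s t, code s = code t -> valid W s t) ->
  exists F : algebra Sg,
    [/\ finite_algebra F, W F &
      forall s t : term Sg X, valid [set F]%classic s t -> valid W s t].
Proof.
move=> [E WE] codeP.
pose cls s := [set z | `[< exists2 t, code t = z & valid W s t >]].
pose rank s : nat := enum_rank (cls s).
have rankP s t : rank s = rank t <-> valid W s t.
  split=> [/ord_inj/enum_rank_inj/setP/(_ (code t))|st].
    rewrite !inE [RHS]asboolT; last by exists t.
    by move=> /asboolP[t' /codeP t't st'] C WC v; rewrite (st' C WC) (t't C WC).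
  congr (nat_of_ord (enum_rank _)); apply/setP => z; rewrite !inE.
  by apply: asbool_equiv_eq; split=> -[r rz sr]; exists r => // C WC v;
    rewrite -(sr C WC) (st C WC).
pose F := {z : nat | exists s, rank s = z}.
pose cl s : F := exist _ (rank s) (ex_intro _ s erefl).
have clP s t : cl s = cl t <-> valid W s t.
  rewrite -rankP; split=> [/(congr1 (@proj1_sig _ _))//|st].
  exact: eq_exist.
have /choice[rep repK] (b : F) : exists s, cl s = b.
  by case: b => c [s cs]; exists s; apply: eq_exist.
pose op f (args : (F ^ arity f)%type) := cl (App [ffun i => rep (args i)]).
pose FA := @Algebra Sg F op.
have evalE Y (u : Y -> term Sg X) s :
    eval (fun y => cl (u y) : FA) s = cl (subst u s).
  elim/term_induction: s => [y //|f args IH] /=; apply/clP => C WC v /=.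
  congr interp; apply/ffunP => i; rewrite !ffunE.
  by have /clP := repK (cl (subst u (args i))); rewrite IH; apply.
exists FA; split=> [||s t /(_ FA erefl (fun x => cl (Var Sg x)))].
- rewrite /finite_algebra; pose B := [set m | m < #|{set Z}|]%classic.
  suff -> : [set: FA]%classic = (@proj1_sig _ _ @^-1` B)%classic.
    by apply: finite_preimage (finite_II _) => -[a ?] [b ?] _ _ /=; apply: eq_exist.
  apply/seteqP; split=> // b _; have [s sb] := proj2_sig b.
  by rewrite /B /preimage /mkset -sb; apply: ltn_ord.
- rewrite WE => s t Est v.
  have vE : (fun y => cl (rep (v y)) : FA) =1 v by move=> y; apply: repK.
  rewrite -!(eq_eval _ vE) !evalE; apply/clP => C.
  by rewrite WE => /(_ s t Est) Cst w; rewrite !eval_subst; apply: Cst.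
- rewrite !evalE => /clP st C WC v; have := st C WC v.
  by rewrite !eval_subst.
Qed.

End Terms.
(** * Identities as functions on words *)

Section IdentitiesOfFiniteAlgebra.

Variables (Sg : signature) (A : algebra Sg).
Variables (disp : Order.disp_t) (T : finOrderType disp).
Variables (toT : A -> T) (ofT : T -> A).
Hypotheses (toTK : cancel toT ofT) (ofTK : cancel ofT toT).
Implicit Types (K W : set (algebra Sg)) (m n : nat).

Definition value m (s : term Sg 'I_m) (x : m.-tuple T) : T :=
  toT (eval (fun i => ofT (tnth x i)) s).

Definition identities K m : set (m.-tuplelexi T -> T * T) :=
  fun g => exists s t : term Sg 'I_m,
    valid K s t /\ forall x, g x = (value s x, value t x).

Definition minor m m' (u : 'I_m -> 'I_m') (x : m'.-tuple T) : m.-tuple T :=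
  [tuple tnth x (u j) | j < m].

Lemma value_rename m m' (u : 'I_m -> 'I_m') s x :
  value (rename u s) x = value s (minor u x).
Proof.
rewrite /value eval_rename; congr toT; apply: eq_eval => i /=.
by rewrite tnth_mktuple.
Qed.

Lemma identities_minor K m m' (u : 'I_m -> 'I_m') (g : m.-tuplelexi T -> T * T) :
  identities K g -> @identities K m' (fun x => g (minor u x)).
Proof.
move=> [s [t [Kst gE]]]; exists (rename u s), (rename u t).
split=> [|x]; first exact: valid_rename.
by rewrite gE !value_rename.
Qed.

Lemma valid_of_value K m (s t : term Sg 'I_m.+1) :
  (K `<=` generated_variety A)%classic -> value s =1 value t -> valid K s t.
Proof.
move=> KA st; apply: (valid_of_generator KA) => v.
have := congr1 ofT (st [tuple toT (v i) | i < m.+1]); rewrite /value !toTK.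
by rewrite !(@eq_eval _ A _ _ v)// => i; rewrite tnth_mktuple toTK.
Qed.

(** Let [x] be below [u], with [i] the first difference, and let [j] be the first
    position that [s] maps to [i]. Before [j] only positions smaller than [i] are
    read, so [j] is the first place where the two minors differ. *)
Lemma minor_rigid (u v : seq T) (s : nat -> nat) : rigid_minor s u v ->
  exists r : 'I_(size v) -> 'I_(size u),
    minor r (in_tuple u) = in_tuple v /\
    forall x : (size u).-tuplelexi T, (x < (in_tuple u : (size u).-tuplelexi T))%O ->
      ((minor r x : (size v).-tuplelexi T) < in_tuple v)%O.
Proof.
move=> [s_lt s_nth s_first].
pose r (j : 'I_(size v)) := Ordinal (s_lt j (ltn_ord j)).
have uv : minor r (in_tuple u) = in_tuple v.
  apply: eq_from_tnth => j; rewrite tnth_mktuple.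
  have d := tnth (in_tuple v) j.
  by rewrite !(tnth_nth d) /= s_nth.
exists r; split=> // x /Order.TupleLexiOrder.ltxi_tuplePlt[i xu xi].
have [j [jv sj] jfirst] := s_first i (ltn_ord i).
have rj : r (Ordinal jv) = i by apply: val_inj.
apply/Order.TupleLexiOrder.ltxi_tuplePlt; rewrite -uv.
exists (Ordinal jv) => [j' j'j|]; last by rewrite !tnth_mktuple rj.
by rewrite !tnth_mktuple; apply: xu; apply: jfirst.
Qed.

Lemma fork_rigid K (u v : seq T) s b c : rigid_minor s u v ->
    fork (identities K (m := size v)) (in_tuple v) b c ->
  fork (identities K (m := size u)) (in_tuple u) b c.
Proof.
move=> /minor_rigid[r [ruv rlt]] [f [g [Kf Kg fg fv gv]]].
exists (fun x => f (minor r x)), (fun x => g (minor r x)).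
split; rewrite ?ruv//; try exact: identities_minor.
by move=> x /rlt; apply: fg.
Qed.

Lemma fork_in_tuple K m (w : m.-tuple T) b c :
  fork (identities K (m := m)) w b c <->
  fork (identities K (m := size w)) (in_tuple w) b c.
Proof.
case: w => w wm /=; move: (wm); rewrite -(eqP wm) => wm'.
by rewrite (_ : Tuple wm' = in_tuple w)//; apply: val_inj.
Qed.

Variables (k : nat) (edge : term Sg 'I_k.+1).
Hypotheses (k_ge2 : 2 <= k) (edgeP : edge_operation (term_function A edge)).

Definition edge_pair (a : ((T * T) ^ k.+1)%type) : T * T :=
  (toT (term_function A edge [ffun j => ofT (a j).1]),
   toT (term_function A edge [ffun j => ofT (a j).2])).

Lemma edge_pairP : edge_operation edge_pair.
Proof.
move=> [x1 x2] [y1 y2].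
have [e01 e02 e3] := edgeP (ofT x1) (ofT y1).
have [f01 f02 f3] := edgeP (ofT x2) (ofT y2).
split=> [||l l3]; rewrite /edge_pair; congr pair; apply: (canLR ofTK);
  [rewrite -[RHS]e01|rewrite -[RHS]f01|rewrite -[RHS]e02|rewrite -[RHS]f02
  |rewrite -[RHS](e3 l l3)|rewrite -[RHS](f3 l l3)];
  by congr term_function; apply/ffunP => j; rewrite !ffunE; case: ifP.
Qed.

Lemma identities_closed K m : closed_under edge_pair (identities K (m := m)).
Proof.
move=> F KF.
have /choice[p pP] (j : 'I_k.+1) : exists p : term Sg 'I_m * term Sg 'I_m,
    valid K p.1 p.2 /\ forall x, F j x = (value p.1 x, value p.2 x).
  by have [s [t st]] := KF j; exists (s, t).
exists (subst (fun j => (p j).1) edge), (subst (fun j => (p j).2) edge).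
split=> [C KC v|x].
  by rewrite !eval_subst; apply: eq_eval => j; apply: (pP j).1.
rewrite /edge_pair /value !eval_subst /term_function.
by congr (toT _, toT _); apply: eq_eval => j; rewrite !ffunE (pP j).2 toTK.
Qed.

(** [u] identifies two variables when all words in [X] have the same letters
    there, and [u'] picks one variable from each class. *)
Lemma minor_small_support n m (X : {set m.+1.-tuple T}) :
    #|X| < k -> #|T|.+1 ^ k <= n.+1 ->
  exists (u : 'I_m.+1 -> 'I_n.+1) (u' : 'I_n.+1 -> 'I_m.+1),
    {in X, forall x, minor u (minor u' x) = x}.
Proof.
move=> Xk kn.
pose col (i : 'I_m.+1) := [ffun l : 'I_#|X| => tnth (enum_val l) i].
have col_lt (i : 'I_m.+1) : enum_rank (col i) < n.+1.
  apply: leq_trans (ltn_ord _) (leq_trans _ kn).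
  rewrite card_ffun card_ord (@leq_trans (#|T|.+1 ^ #|X|))//.
    by case: {+}#|X| => // l; rewrite leq_exp2r.
  by rewrite leq_pexp2l// ltnW.
pose u i := Ordinal (col_lt i).
pose u' j := odflt ord0 [pick i | u i == j].
exists u, u' => x xX; apply: eq_from_tnth => i; rewrite !tnth_mktuple /u'.
case: pickP => [i' /eqP/(congr1 val)/= /ord_inj/enum_rank_inj/ffunP|/(_ i)].
  by move=> /(_ (enum_rank_in xX x)); rewrite !ffunE enum_rankK_in.
by rewrite eqxx.
Qed.

(** [n] is so large that words of at most [n] letters witness the lack of a fork
    of [W], and that projections to fewer than [k] words are visible in [n.+1]
    variables. The identities of [W] and of [B] then have the same forks and the
    same small projections for every number of variables, so [edge_interpolation]
    applies. *)
Theorem identities_determined_by_arity W : (W `<=` generated_variety A)%classic ->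
  exists n, forall B, W B ->
    (forall s t : term Sg 'I_n.+1, valid [set B]%classic s t -> valid W s t) ->
  (W `<=` generated_variety B)%classic.
Proof.
move=> WA.
have [n0 n0P] := @rigid_minor_basis T (T * T * (T * T))%type (fun bc w =>
  ~ fork (identities W (m := size w)) (in_tuple w) bc.1 bc.2).
pose n := maxn n0 (#|T|.+1 ^ k).
have n0n : n0 <= n by apply: leq_maxl.
have kn : #|T|.+1 ^ k <= n.+1 by apply/leqW/leq_maxr.
exists n => B WB BW; pose V := [set B]%classic.
have VW m (g : m.-tuplelexi T -> T * T) : 0 < m <= n.+1 ->
    identities V g -> identities W g.
  case: m g => // m g mn [s [t [Vst gE]]]; exists s, t; split=> //.
  have wK : cancel (widen_ord mn) (fun i : 'I_n.+1 => inord i : 'I_m.+1).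
    by move=> i; apply: inord_val.
  by apply: (valid_rename_cancel wK); apply/BW/valid_rename.
have WV m : (identities W (m := m) `<=` identities V (m := m))%classic.
  by move=> g [s [t [Wst gE]]]; exists s, t; split=> // _ ->; apply: Wst.
have VfW m (w : m.+1.-tuple T) b c :
    fork (identities V (m := m.+1)) w b c -> fork (identities W (m := m.+1)) w b c.
  move=> /fork_in_tuple Vw; apply/fork_in_tuple; apply: contrapT => nWw.
  have [u [nWu un] [r ruw]] := n0P (b, c) w nWw; apply: nWu => /=.
  have [f [g [Vf Vg fg fu gu]]] := fork_rigid ruw Vw.
  have u0 : 0 < size u <= n.+1.
    rewrite (leq_trans un) ?leqW// andbT; case: ruw => /(_ 0).
    by rewrite size_tuple => /(_ isT) + _ _; case: (size u).
  by exists f, g; split=> //; apply: VW.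
have valid_VW m (s t : term Sg 'I_m.+1) : valid V s t -> valid W s t.
  move=> Vst; pose g (x : m.+1.-tuplelexi T) := (value s x, value t x).
  have Vg : identities V g by exists s, t.
  have small (g' : m.+1.-tuplelexi T -> T * T) (X : {set m.+1.-tuplelexi T}) :
      identities V g' -> #|X| < k ->
      exists2 f, identities W f & {in X, f =1 g'}.
    move=> Vg' Xk; have [u [u' uX]] := minor_small_support Xk kn.
    exists (fun x => g' (minor u (minor u' x))); last first.
      by move=> x xX /=; rewrite uX.
    apply: (identities_minor u' (_ : identities W (fun x => g' (minor u x)))).
    by apply: VW; rewrite ?leqnn//; apply: identities_minor.
  have [r [s' [t' [Wst' rE]]] rg] := edge_interpolation k_ge2 edge_pairP
    (@identities_closed W m.+1) (@identities_closed V m.+1) (@VfW m) small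
    (@WV m.+1) Vg.
  have gE x : (value s' x, value t' x) = (value s x, value t x).
    by rewrite -rE rg.
  have ss' : valid W s' s by apply: (valid_of_value WA) => x; case: (gE x).
  have tt' : valid W t' t by apply: (valid_of_value WA) => x; case: (gE x).
  by move=> C WC v; rewrite -(ss' C WC) -(tt' C WC); apply: Wst'.
move=> C WC s t Bst v.
have [[ms msP] [mt mtP]] := (rename_finite_support s, rename_finite_support t).
pose m := maxn ms mt; pose r := @inord m.
have Vst : valid V (rename r s) (rename r t).
  by apply: valid_rename => _ -> w; apply: Bst.
have := valid_rename (@nat_of_ord m.+1) (valid_VW _ _ _ Vst) WC v.
by rewrite msP ?leq_maxl// mtP ?leq_maxr.
Qed.

End IdentitiesOfFiniteAlgebra.
(** * Subvarieties are finitely generated *)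

Lemma finite_enumeration (X : Type) : finite_set [set: X]%classic ->
  exists (q : nat) (f : X -> 'I_q) (g : 'I_q -> X), cancel f g /\ cancel g f.
Proof.
move=> [q /card_set_bijP[f [f_lt f_inj f_surj]]]; exists q.
have f_ltq x : f x < q by apply: f_lt.
have /choice[g gP] (i : 'I_q) : exists x, f x = i.
  by have [x _ fx] := f_surj i (ltn_ord i); exists x.
exists (fun x => Ordinal (f_ltq x)), g; split=> [x|i]; last exact/val_inj/gP.
by apply: f_inj; rewrite ?inE ?gP.
Qed.

Local Open Scope classical_set_scope.

Theorem theorem1p2 (S : signature) (A : algebra S)
    (finA : finite_algebra A) (edgeA : has_edge_term A)
    (W : set (algebra S)) (varW : variety W)
    (subW : W `<=` generated_variety A) :
  exists B : algebra S,
    [/\ finite_algebra B, W B & W = generated_variety B].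
Proof.
have [q [toT [ofT [toTK ofTK]]]] := finite_enumeration finA.
have [k [k_ge2 [edge edgeP]]] := edgeA.
have [n nP] := identities_determined_by_arity toTK ofTK k_ge2 edgeP subW.
pose code (s : term S 'I_n.+1) : {ffun n.+1.-tuple 'I_q -> 'I_q} :=
  [ffun x => value toT ofT s x].
have codeP s t : code s = code t -> valid W s t.
  move=> /ffunP st; apply: (valid_of_value toTK subW) => x.
  by have := st x; rewrite !ffunE.
have [B [finB WB BW]] := finite_free_algebra varW codeP.
exists B; split=> //; apply/seteqP; split; first exact: nP.
exact: generated_variety_smallest.
Qed.
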